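(* Let $a\geq b\geq 2$ be integers, let $n=a+b+3$, and let $X=\mathrm{Spider}(a,b,1,1)$, a graph on $n$ vertices. Then for every integer $c$ with $3\leq c\leq n$, the friends-and-strangers graph $\mathrm{FS}(X,\overline{\mathrm{Tad}_{c,n-c}})$ is connected.
   Context: All graphs are finite and simple, and $[n]=\{1,\dots,n\}$. The complement $\overline{G}$ of a graph $G$ has vertex set $V(G)$, and two distinct vertices are adjacent in $\overline{G}$ iff they are not adjacent in $G$. Friends-and-strangers graph: for graphs $X,Y$ with $V(X)=V(Y)=[n]$, $\mathrm{FS}(X,Y)$ is the graph whose vertices are all permutations $\sigma$ of $[n]$ (viewed as bijections $V(X)\to V(Y)$), where $\sigma$ and $\phi$ are adjacent iff there is an edge $\{a,b\}\in E(X)$ such that $\{\sigma(a),\sigma(b)\}\in E(Y)$, $\sigma(a)=\phi(b)$, $\sigma(b)=\phi(a)$, and $\sigma(c)=\phi(c)$ for all $c\in V(X)\setminus\{a,b\}$. Graphs on $n$ vertices are labelled by $[n]$ in any way; connectedness of $\mathrm{FS}(X,Y)$ does not depend on the labelling. Spider: for positive integers $\lambda_1\geq\cdots\geq\lambda_k$, $\mathrm{Spider}(\lambda_1,\dots,\lambda_k)$ is the graph on $1+\sum_{i=1}^k\lambda_i$ vertices consisting of a center vertex together with $k$ pairwise disjoint paths (legs) having $\lambda_1,\dots,\lambda_k$ vertices respectively, one endpoint of each leg being joined by an edge to the center (and no other edges). Tadpole: for integers $3\leq c\leq n$, $\mathrm{Tad}_{c,n-c}$ is the graph with vertex set $[n]$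 and edge set $\{\{k,k+1\}:k\in[n-1]\}\cup\{\{1,c\}\}$ (for $c=n$ it is the cycle on $n$ vertices). *)

(* Defs.v *)
From mathcomp Require Import all_boot all_fingroup.

Set Implicit Arguments.
Unset Strict Implicit.
Unset Printing Implicit Defensive.

(* A graph is its adjacency relation [rel T] on a finType [T]; the relations
   defined below are shown to be symmetric and, under their stated conditions,
   irreflexive. The vertex set [n] is 'I_n, the ordinal of value i being the
   vertex i + 1. *)

Definition graph_compl (T : finType) (e : rel T) : rel T :=
  fun x y => (x != y) && ~~ e x y.

Definition graph_iso (T1 T2 : finType) (e1 : rel T1) (e2 : rel T2) : Prop :=
  exists2 f : T1 -> T2, bijective f & forall x y, e1 x y = e2 (f x) (f y).

Definition graph_connected (T : finType) (e : rel T) : Prop :=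
  forall x y : T, connect e x y.

Definition FS (n : nat) (X Y : rel 'I_n) : rel 'S_n :=
  fun sigma phi =>
    [exists a : 'I_n, exists b : 'I_n,
      [&& X a b, Y (sigma a) (sigma b), sigma a == phi b, sigma b == phi a &
          [forall c : 'I_n, (c != a) && (c != b) ==> (sigma c == phi c)]]].

(* None is the center; Some (i, j) is the vertex at distance j + 1 from the
   center on the i-th leg, which has lambda_i vertices. *)
Definition spider_vertex (lambda : seq nat) : finType :=
  option {i : 'I_(size lambda) & 'I_(nth 0 lambda i)}.

Definition spider_arc (lambda : seq nat) (u v : spider_vertex lambda) : bool :=
  match u, v with
  | None, Some q => tagged q == 0 :> nat
  | Some p, Some q =>
      (tag p == tag q) && ((tagged p : nat).+1 == tagged q :> nat)
  | _, None => false
  end.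

Definition spider (lambda : seq nat) : rel (spider_vertex lambda) :=
  fun u v => spider_arc u v || spider_arc v u.

Definition tadpole_arc (n c : nat) (i j : 'I_n) : bool :=
  (i.+1 == j) || (i == 0 :> nat) && (j.+1 == c).

(* Tad_{c,n-c}, for 3 <= c <= n. *)
Definition tadpole (n c : nat) : rel 'I_n :=
  fun i j => tadpole_arc c i j || tadpole_arc c j i.

Lemma card_spider (lambda : seq nat) :
  #|spider_vertex lambda| = (sumn lambda).+1.
Proof.
rewrite card_option card_tagged; congr _.+1; congr sumn.
apply: (@eq_from_nth _ 0); first by rewrite size_map size_enum_ord.
move=> i; rewrite size_map size_enum_ord => lti.
by rewrite (nth_map (Ordinal lti)) ?size_enum_ord // card_ord nth_enum_ord.
Qed.

Lemma spider_sym (lambda : seq nat) : symmetric (@spider lambda).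
Proof. by move=> u v; rewrite /spider orbC. Qed.

Lemma spider_irrefl (lambda : seq nat) : irreflexive (@spider lambda).
Proof.
by case=> [p|] //; rewrite /spider orbb /= (gtn_eqF (ltnSn _)) andbF.
Qed.

Lemma tadpole_sym (n c : nat) : symmetric (@tadpole n c).
Proof. by move=> i j; rewrite /tadpole orbC. Qed.

Lemma tadpole_irrefl (n c : nat) : 3 <= c -> irreflexive (@tadpole n c).
Proof.
move=> c3 i; rewrite /tadpole orbb /tadpole_arc (gtn_eqF (ltnSn i)) /=.
by apply/negP => /andP[/eqP-> /eqP cE]; rewrite -cE in c3.
Qed.

Lemma graph_compl_sym (T : finType) (e : rel T) :
  symmetric e -> symmetric (graph_compl e).
Proof. by move=> es x y; rewrite /graph_compl es eq_sym. Qed.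

Lemma graph_compl_irrefl (T : finType) (e : rel T) :
  irreflexive (graph_compl e).
Proof. by move=> x; rewrite /graph_compl eqxx. Qed.

Lemma FS_sym (n : nat) (X Y : rel 'I_n) :
  symmetric X -> symmetric Y -> symmetric (FS X Y).
Proof.
move=> Xs Ys; suff FSs s t : FS X Y s t -> FS X Y t s.
  by move=> s t; apply/idP/idP; apply: FSs.
case/existsP=> a /existsP[b /and5P[Xab Yab /eqP sa /eqP sb /forallP sc]].
apply/existsP; exists a; apply/existsP; exists b.
rewrite Xab -sa -sb Ys Yab !eqxx /=; apply/forallP => c.
by rewrite [t c == _]eq_sym; apply: sc.
Qed.

Lemma FS_irrefl (n : nat) (X Y : rel 'I_n) :
  irreflexive X -> irreflexive (FS X Y).
Proof.
move=> Xi s; rewrite /FS; apply/existsP=> -[a /existsP[b]].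
case/and5P=> Xab _ /eqP/perm_inj ab _ _.
by rewrite ab Xi in Xab.
Qed.

(* Main.v *)
Require Import Defs.
From mathcomp Require Import all_boot all_fingroup.
From mathcomp Require Import zify.

Set Implicit Arguments.
Unset Strict Implicit.
Unset Printing Implicit Defensive.

(** The spider X contains a copy of Spider(2,2,1,1), called the core below, and
    it is obtained from it by adding vertices one at a time, each joined to an
    earlier one. The theorem follows from two facts about a set D of positions,
    when people are tadpole vertices and two people may trade places across an
    edge of X exactly when they are not adjacent in the tadpole. Call D
    rearrangeable if any two arrangements that agree outside D are connected.

    Growth (rearrangeable_grow). If D is rearrangeable, has at least 7 positions
    and v in D is adjacent to u outside D, then D together with u is
    rearrangeable. Indeed, if u has the same occupant in two arrangements, they
    are connected within D. To replace the occupant x of u by a person y from D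
    who may trade places with x, move y to v within D and swap across the edge
    vu. If x and y may not trade places, go through a third person z who may
    trade with both: at most 6 people are equal or adjacent to one of two
    adjacent tadpole vertices (card_tadpole_blocked), so D always holds such
    a z.

    Base (rearrangeable_core). The core is rearrangeable. Seven people listed by
    increasing tadpole label have ranks 0, ..., 6, and tadpole neighbours have
    consecutive ranks, or ranks 0 and k for one fixed k, the rank of the vertex
    c at which the cycle closes. This leaves finitely many systems of forbidden
    swaps, and for each of them an exhaustive search from the arrangement in
    rank order reaches all 7! arrangements of the core (all_explored).

    The argument applies to every connected graph containing the core
    (FS_tadpole_connected). *)

(** * Rearranging people on a subset of positions *)

Definition agree_outside (T : finType) (D : {set T}) (s t : {perm T}) : Prop :=
  forall x, x \notin D -> s x = t x.

Lemma agree_outside_sym (T : finType) (D : {set T}) (s t : {perm T}) :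
  agree_outside D s t -> agree_outside D t s.
Proof. by move=> st x /st. Qed.

Lemma agree_outside_trans (T : finType) (D : {set T}) (r s t : {perm T}) :
  agree_outside D r s -> agree_outside D s t -> agree_outside D r t.
Proof. by move=> rs st x xD; rewrite rs // st. Qed.

Lemma agree_outside_tperm (T : finType) (D : {set T}) (s : {perm T}) (u v : T) :
  u \in D -> v \in D -> agree_outside D s (tperm u v * s)%g.
Proof.
move=> uD vD x xD; rewrite permM tpermD //; first by apply: contraNneq xD => <-.
by apply: contraNneq xD => <-.
Qed.

(** The people standing in [D] are the same in both arrangements, since those
    standing outside are. *)
Lemma agree_outside_val (T : finType) (D : {set T}) (s t : {perm T}) (x : T) :
  agree_outside D s t -> x \in D -> exists2 w, w \in D & t x = s w.
Proof.
move=> st xD; exists (s^-1 (t x))%g; last by rewrite permKV.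
apply: contraLR xD => wD; have := st _ wD.
by rewrite permKV => /perm_inj xw; rewrite [in X in X \notin D]xw.
Qed.

Definition rearrangeable (n : nat) (X Y : rel 'I_n) (D : {set 'I_n}) : Prop :=
  forall s t, agree_outside D s t -> connect (FS X Y) s t.

Lemma FS_swap (n : nat) (X Y : rel 'I_n) (s : 'S_n) (u v : 'I_n) :
  X u v -> Y (s u) (s v) -> FS X Y s (tperm u v * s)%g.
Proof.
move=> Xuv Yuv; apply/existsP; exists u; apply/existsP; exists v.
rewrite Xuv Yuv !permM tpermL tpermR !eqxx /=.
apply/forallP=> c; apply/implyP=> /andP[cu cv].
by rewrite permM tpermD // eq_sym.
Qed.

(** The cardinality hypothesis provides, for two people who cannot swap, a
    go-between standing in [D] who can swap with both; it bounds the number of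
    people unfit for this, and those include the two people themselves. *)
Lemma rearrangeable_grow (n : nat) (X Y : rel 'I_n) (D : {set 'I_n})
    (u v : 'I_n) :
    symmetric Y ->
    (forall x y, x != y -> ~~ Y x y ->
       #|[set z | ~~ (Y x z && Y z y)]| < #|D|) ->
    v \in D -> u \notin D -> X v u ->
  rearrangeable X Y D -> rearrangeable X Y (u |: D).
Proof.
move=> Ysym Yfew vD uD Xvu Dok.
(* The occupants of u in s and t may swap: bring t u to v, then swap across
   the edge v u. *)
have befriended s t : agree_outside (u |: D) s t -> Y (s u) (t u) ->
  connect (FS X Y) s t.
  move=> st Yst.
  have [w wD tw] := agree_outside_val st (setU11 u D).
  case/setU1P: wD => [wu | wD].
    apply: Dok => x xD; have [->|xu] := eqVneq x u; first by rewrite tw wu.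
    by apply: st; rewrite !inE negb_or xu.
  pose s1 := (tperm v w * s)%g.
  have ss1 : agree_outside D s s1 by apply: agree_outside_tperm.
  have s1u : s1 u = s u by rewrite -(ss1 u uD).
  have s1v : s1 v = t u by rewrite permM tpermL tw.
  apply: connect_trans (Dok _ _ ss1) _.
  apply: (@connect_trans _ _ (tperm v u * s1)%g).
    by apply/connect1/FS_swap; rewrite // s1u s1v Ysym.
  apply: Dok => x xD; have [->|xu] := eqVneq x u.
    by rewrite permM tpermR s1v.
  have xv : x != v by apply: contraNneq xD => ->.
  rewrite permM tpermD 1?eq_sym // -ss1 //.
  by apply: st; rewrite !inE negb_or xu.
move=> s t st; have [xy | xy] := eqVneq (s u) (t u).
  apply: Dok => x xD; have [->//|xu] := eqVneq x u.
  by apply: st; rewrite !inE negb_or xu.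
have [/befriended|Yxy] := boolP (Y (s u) (t u)); first exact.
have /subsetPn[z /imsetP[w wD ->]] :
    ~~ (s @: D \subset [set z | ~~ (Y (s u) z && Y z (t u))]).
  apply: contraTN (Yfew _ _ xy Yxy) => /subset_leq_card.
  by rewrite card_imset -?leqNgt //; apply: perm_inj.
rewrite inE negbK => /andP[Yxz Yzy].
have sr : agree_outside (u |: D) s (tperm u w * s)%g.
  by apply: agree_outside_tperm; rewrite !inE ?eqxx ?wD ?orbT.
apply: connect_trans (befriended _ _ sr _) (befriended _ _ _ _).
- by rewrite permM tpermL.
- exact: agree_outside_trans (agree_outside_sym sr) st.
by rewrite permM tpermL.
Qed.

(** A proper nonempty set of vertices of a connected graph has an edge leaving
    it, so growth does not stop before all positions are included. *)
Lemma rearrangeable_setT (n : nat) (X Y : rel 'I_n) (D : {set 'I_n}) :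
    symmetric X -> symmetric Y -> graph_connected X -> 0 < #|D| ->
    (forall x y, x != y -> ~~ Y x y ->
       #|[set z | ~~ (Y x z && Y z y)]| < #|D|) ->
  rearrangeable X Y D -> graph_connected (FS X Y).
Proof.
move=> Xsym Ysym Xcon.
have [m] := ubnP #|~: D|; elim: m D => // m IHm D Dm D0 Yfew Dok.
have [DT | DT] := eqVneq D setT.
  by move=> s t; apply: Dok => x; rewrite DT inE.
have [v [u [vD uD Xvu]]] : exists v u, [/\ v \in D, u \notin D & X v u].
  case: (pickP [pred p | [&& p.1 \in D, p.2 \notin D & X p.1 p.2]]) => /=.
    by case=> v u /and3P[]; exists v, u.
  move=> noedge; case/negP: DT; apply/eqP/setP => y; rewrite inE.
  have /card_gt0P[x xD] := D0.
  have Dcl : closed X (mem D).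
    apply: intro_closed; first exact: sym_connect_sym.
    move=> v u Xvu /= vD.
    by apply: contraFT (noedge (v, u)) => uD; rewrite /= Xvu uD vD.
  by rewrite -(closed_connect Dcl (Xcon x y)).
have DuD : #|D| < #|u |: D| by rewrite cardsU1 uD.
apply: (IHm (u |: D)) (rearrangeable_grow Ysym Yfew vD uD Xvu Dok).
- rewrite -ltnS; apply: leq_trans Dm; rewrite ltnS.
  by apply/proper_card; rewrite properC; apply: properUr; rewrite sub1set.
- exact: leq_trans DuD.
move=> x y xy Yxy; exact: ltn_trans (Yfew _ _ xy Yxy) DuD.
Qed.

(** * The complement of a tadpole has few non-edges *)

Lemma card_ord_le_size (n : nat) (P : pred 'I_n) (l : seq nat) :
  (forall z, P z -> val z \in l) -> #|[set z | P z]| <= size l.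
Proof.
move=> Pl; rewrite cardE -(size_map val); apply: uniq_leq_size.
  by rewrite (map_inj_uniq val_inj) enum_uniq.
by move=> w /mapP[z]; rewrite mem_enum inE => /Pl zl ->.
Qed.

Lemma card_tadpole_blocked (n c : nat) (x y : 'I_n) :
    let Y := graph_compl (@tadpole n c) in
    x != y -> ~~ Y x y ->
  #|[set z | ~~ (Y x z && Y z y)]| < 7.
Proof.
move=> Y xy Yxy.
wlog arc : x y xy Yxy / tadpole_arc c x y.
  move=> main; have: tadpole_arc c x y || tadpole_arc c y x.
    by move: Yxy; rewrite negb_and negbK (negPf xy) negbK.
  case/orP => [/main|arc]; first exact.
  have Ysym : symmetric Y by apply/graph_compl_sym/tadpole_sym.
  have -> : [set z | ~~ (Y x z && Y z y)] = [set z | ~~ (Y y z && Y z x)].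
    by apply/setP=> z; rewrite !inE andbC Ysym [Y x z]Ysym.
  by apply: main; rewrite // 1?eq_sym // Ysym.
(* The arc x -> y is either a path edge, y = x + 1, or the chord, x = 0 and
   y = c - 1. In the first case only the path neighbours x - 1, y + 1 and the
   endpoints 0, c - 1 of the chord can be blocked besides x and y; in the
   second, only 1, c - 2 and c. *)
apply: (@leq_ltn_trans
  (size [:: x : nat; y : nat; x.-1; y.+1;
            if x.+1 == y then 0 else 1;
            if x.+1 == y then c.-1 else c.-2])) => //.
apply: card_ord_le_size => z.
move: arc xy; rewrite /Y /graph_compl /tadpole /tadpole_arc !inE.
rewrite -!(inj_eq val_inj) /=.
case: eqP => ? /=; lia.
Qed.

(** * Seven people on the core *)

(** The path 0 - 1 - 2 - 3 - 4 with two leaves 5 and 6 attached to its midpoint,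
    that is, Spider(2,2,1,1) with center 2. *)
Definition core_edges : seq (nat * nat) :=
  [:: (0, 1); (1, 2); (2, 3); (3, 4); (2, 5); (2, 6)].

(** An upper bound for the adjacency that a tadpole induces between the ranks of
    seven of its vertices, where [k] is the rank of the second endpoint of the
    chord: consecutive ranks count as adjacent even if the labels are not
    consecutive, and rank 0 is treated as the first endpoint. *)
Definition foe (k i j : nat) : bool :=
  [|| i.+1 == j, j.+1 == i, (i == 0) && (j == k) | (j == 0) && (i == k)].

(** The transposition of [i] and [j] as a function on [nat], so that the search
    computes. *)
Definition exchange (i j l : nat) : nat :=
  if l == i then j else if l == j then i else l.

(** An arrangement of the core is the list [s] of the ranks of the people
    standing at positions 0, ..., 6. *)
Definition swapped (e : nat * nat) (s : seq nat) : seq nat :=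
  mkseq (fun l => nth 0 s (exchange e.1 e.2 l)) 7.

Definition neighbors (k : nat) (s : seq nat) : seq (seq nat) :=
  [seq swapped e s | e <- core_edges & ~~ foe k (nth 0 s e.1) (nth 0 s e.2)].

(** Sets of visited arrangements are stored as tries, because testing membership
    in a list of up to 5040 arrangements would make the search quadratic. *)
Inductive trie := Nil | Node of bool & seq trie.

Definition hit t := if t is Node b _ then b else false.
Definition kids t := if t is Node _ ts then ts else [::].

Fixpoint mem_trie (t : trie) (s : seq nat) : bool :=
  if s is x :: s' then mem_trie (nth Nil (kids t) x) s' else hit t.

Fixpoint add_trie (t : trie) (s : seq nat) : trie :=
  if s is x :: s' then
    Node (hit t) (set_nth Nil (kids t) x (add_trie (nth Nil (kids t) x) s'))
  else Node true (kids t).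

Lemma mem_trie_Nil (s : seq nat) : mem_trie Nil s = false.
Proof. by elim: s => //= x s; rewrite nth_nil. Qed.

Lemma mem_add_trie (t : trie) (s r : seq nat) :
  mem_trie (add_trie t s) r = (r == s) || mem_trie t r.
Proof.
elim: s t r => [|x s IHs] t [|y r] //=.
rewrite nth_set_nth /= eqseq_cons; by have [->|] //= := eqVneq y x.
Qed.

(** [acc] holds the arrangements first met in the current round and the set of
    all those met so far. *)
Definition visit (acc : seq (seq nat) * trie) (s : seq nat) :=
  if mem_trie acc.2 s then acc else (s :: acc.1, add_trie acc.2 s).

Fixpoint explore (k fuel : nat) (front : seq (seq nat)) (seen : trie) : trie :=
  if fuel is fuel'.+1 then
    let acc :=
      foldl visit ([::], seen) (flatten [seq neighbors k s | s <- front]) in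
    explore k fuel' acc.1 acc.2
  else seen.

(** The search is used through this invariant only; that it finds every
    arrangement is read off from the result of the computation. *)
Lemma explore_sound (k fuel : nat) (P : seq nat -> Prop) front seen :
    (forall s t, P s -> t \in neighbors k s -> P t) ->
    (forall s, s \in front -> P s) -> (forall s, mem_trie seen s -> P s) ->
  forall s, mem_trie (explore k fuel front seen) s -> P s.
Proof.
move=> Pstep; elim: fuel front seen => [|fuel IHf] front seen //= Pfront Pseen.
have visitP l acc :
    (forall s, s \in l -> P s) -> (forall s, s \in acc.1 -> P s) ->
    (forall s, mem_trie acc.2 s -> P s) ->
  (forall s, s \in (foldl visit acc l).1 -> P s) /\
  (forall s, mem_trie (foldl visit acc l).2 s -> P s).
  elim: l acc => [|r l IHl] acc Pl Pacc1 Pacc2 //=.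
  have Pr : P r by apply: Pl; rewrite mem_head.
  apply: IHl => [s sl | s | s].
  - by apply: Pl; rewrite inE sl orbT.
  - rewrite /visit; case: ifP => _; first exact: Pacc1.
    by rewrite inE => /predU1P[->|/Pacc1].
  rewrite /visit; case: ifP => _; first exact: Pacc2.
  by rewrite mem_add_trie => /predU1P[->|/Pacc2].
have Pnext s : s \in flatten [seq neighbors k r | r <- front] -> P s.
  by move=> /flatten_mapP[r /Pfront Pr /(Pstep _ _ Pr)].
have [//|P1 P2] := visitP _ ([::], seen) Pnext _ Pseen.
exact: IHf P1 P2.
Qed.

(** No arrangement is more than 30 swaps away from the ordered one, whatever
    [k] is; the ordered arrangement itself is recorded when it is met again. *)
Definition explored (k : nat) : trie := explore k 31 [:: iota 0 7] Nil.

Lemma all_explored (k : nat) :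
  k <= 7 -> all (mem_trie (explored k)) (permutations (iota 0 7)).
Proof.
move=> k7.
have: all (fun k => all (mem_trie (explored k)) (permutations (iota 0 7)))
  (iota 0 8) by vm_compute.
by move/allP; apply; rewrite mem_iota.
Qed.

(** * Abstract and actual arrangements *)

Lemma foe_sym (k i j : nat) : foe k i j = foe k j i.
Proof.
by rewrite /foe orbCA; congr [|| _, _ | _]; rewrite orbC.
Qed.

Lemma exchangeK (i j : nat) : involutive (exchange i j).
Proof.
move=> l; rewrite /exchange; have [->|li] := eqVneq l i.
  by rewrite eqxx; case: eqP.
have [->|lj] := eqVneq l j; first by rewrite eqxx.
by rewrite (negPf li) (negPf lj).
Qed.

Lemma exchange_lt (i j m l : nat) :
  i < m -> j < m -> l < m -> exchange i j l < m.
Proof. by rewrite /exchange; case: (l == i) => //; case: (l == j). Qed.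

Lemma core_edges_lt (e : nat * nat) :
  e \in core_edges -> [&& e.1 < 7, e.2 < 7 & e.1 != e.2].
Proof. by move: e; apply/allP. Qed.

Lemma tperm_nth (T : finType) (x0 : T) (p : seq T) (i j l : nat) :
    uniq p -> i < size p -> j < size p -> l < size p ->
  tperm (nth x0 p i) (nth x0 p j) (nth x0 p l) = nth x0 p (exchange i j l).
Proof.
move=> p_uniq ip jp lp; rewrite /exchange.
rewrite -(nth_uniq x0 lp ip p_uniq) -(nth_uniq x0 lp jp p_uniq).
case: tpermP => [->|->|/eqP li /eqP lj]; rewrite ?eqxx //.
  by case: eqP.
by rewrite (negPf li) (negPf lj).
Qed.

(** The arrangement [s] puts on the core positions [p] the people of [q] whose
    ranks are prescribed by [w]. *)
Definition realizes (T : finType) (x0 : T) (p q : seq T) (s : {perm T})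
    (w : seq nat) : Prop :=
  forall l, l < 7 -> s (nth x0 p l) = nth x0 q (nth 0 w l).

Lemma realizes_swapped (T : finType) (x0 : T) (p q : seq T) s w e :
    uniq p -> size p = 7 -> e \in core_edges ->
    realizes x0 p q s (swapped e w) ->
  realizes x0 p q (tperm (nth x0 p e.1) (nth x0 p e.2) * s)%g w.
Proof.
move=> p_uniq p7 /core_edges_lt/and3P[e1 e2 _] sw l l7.
rewrite permM tperm_nth ?p7 // sw ?exchange_lt // nth_mkseq ?exchange_lt //.
by rewrite exchangeK.
Qed.

(** Between two people with consecutive labels there is no third one, so their
    ranks are consecutive; and label 0, if present, has rank 0. The rank [k] is
    7 when no one in [q] is the second endpoint of the chord, and then the chord
    forbids no swap. *)
Lemma tadpole_ranks (n c : nat) (x0 : 'I_n) (q : seq 'I_n) :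
    size q = 7 -> sorted ltn (map val q) ->
  exists2 k, k <= 7 & forall i j, i < 7 -> j < 7 ->
    tadpole c (nth x0 q i) (nth x0 q j) -> foe k i j.
Proof.
move=> q7 q_sorted; exists (find (fun t : 'I_n => t.+1 == c) q).
  by rewrite -q7 find_size.
set k := find _ _.
have q_lt i j : i < 7 -> j < 7 -> (nth x0 q i < nth x0 q j) = (i < j).
  move=> i7 j7; rewrite -!(nth_map _ 0 val) ?q7 //.
  have q_ltn := sorted_ltn_nth ltn_trans 0 q_sorted.
  case: (ltngtP i j) => [ij|ji|->]; last by rewrite ltnn.
    by apply: q_ltn; rewrite ?inE ?size_map ?q7.
  apply/negbTE; rewrite -leqNgt ltnW //.
  by apply: q_ltn; rewrite ?inE ?size_map ?q7.
have arcP i j : i < 7 -> j < 7 -> tadpole_arc c (nth x0 q i) (nth x0 q j) ->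
    (i.+1 == j) || (i == 0) && (j == k).
  move=> i7 j7 /orP[/eqP qij|/andP[/eqP qi0 qjc]].
    apply/orP; left; have ij : i < j by rewrite -q_lt // -qij.
    rewrite eqn_leq ij leqNgt; apply/negP => i1j.
    have i17 := ltn_trans i1j j7.
    have := q_lt _ _ i17 j7; have := q_lt _ _ i7 i17; lia.
  apply/orP; right; apply/andP; split.
    by rewrite -leqn0 leqNgt -(q_lt 0 i) // qi0.
  have kj : k <= j.
    by rewrite leqNgt; apply/negP=> /(before_find x0); rewrite qjc.
  have k7 : k < 7 by apply: leq_ltn_trans kj j7.
  have qkc : (nth x0 q k).+1 == c.
    by apply: (@nth_find _ x0 (fun t : 'I_n => t.+1 == c)); rewrite has_find q7.
  have := q_lt _ _ k7 j7; lia.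
move=> i j i7 j7 /orP[/arcP|/arcP] => [/(_ i7 j7)|/(_ j7 i7)];
  by rewrite /foe => /orP[->|->]; rewrite ?orbT.
Qed.

(** * The core *)

(** Both arrangements are brought to the one that has the people of the core in
    increasing order and is unchanged outside; as swaps are reversible, the two
    are connected. *)
Lemma rearrangeable_core (n c : nat) (X : rel 'I_n) (x0 : 'I_n)
    (p : seq 'I_n) :
    symmetric X -> uniq p -> size p = 7 ->
    (forall e, e \in core_edges -> X (nth x0 p e.1) (nth x0 p e.2)) ->
  rearrangeable X (graph_compl (@tadpole n c)) [set x in p].
Proof.
move=> Xsym p_uniq p7 Xp s t st; set Y := graph_compl _.
have Ysym : symmetric Y by apply/graph_compl_sym/tadpole_sym.
pose q := sort (relpre val leq) [seq s x | x <- p].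
have q7 : size q = 7 by rewrite size_sort size_map.
have q_perm r : agree_outside [set x in p] s r -> perm_eq q (map r p).
  move=> sr; rewrite perm_sort perm_sym.
  have r_uniq : uniq (map r p) by rewrite (map_inj_uniq perm_inj).
  apply: uniq_perm; rewrite ?(map_inj_uniq perm_inj) //.
  have r_sub : {subset map r p <= map s p}.
    move=> y /mapP[x xp ->].
    have [|w] := agree_outside_val (x := x) sr; first by rewrite inE.
    by rewrite inE => wp ->; apply: map_f.
  by case: (uniq_min_size r_uniq r_sub); rewrite // !size_map.
have q_uniq : uniq q.
  by rewrite (perm_uniq (q_perm s _)) // (map_inj_uniq perm_inj).
have q_sorted : sorted ltn (map val q).
  rewrite ltn_sorted_uniq_leq (map_inj_uniq val_inj) q_uniq sorted_map.
  by apply: sort_sorted => x y; apply: leq_total.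
have [k k7 tad_foe] := tadpole_ranks c x0 q7 q_sorted.
(* The search runs from the ordered arrangement outwards, so its paths are
   followed backwards here: each new swap comes first. Ranks are required to
   be below 7 to keep the default value of nth out of q. *)
pose normalizable w := (forall l, l < 7 -> nth 0 w l < 7) /\
  forall r, realizes x0 p q r w ->
    exists2 r', agree_outside [set x in p] r r' & connect (FS X Y) r r' /\
      realizes x0 p q r' (iota 0 7).
have normalizable_explored : forall w,
    mem_trie (explored k) w -> normalizable w.
  apply: explore_sound => [v w [v7 to_v] | w | w];
    last by rewrite mem_trie_Nil.
    case/mapP=> e; rewrite mem_filter => /andP[efoe ecore] ->.
    have /and3P[e1 e2 e12] := core_edges_lt ecore.
    have w7 l : l < 7 -> nth 0 (swapped e v) l < 7.
      by move=> l7; rewrite nth_mkseq // v7 // exchange_lt.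
    split=> // r rw.
    have [e1p e2p] : nth x0 p e.1 \in p /\ nth x0 p e.2 \in p.
      by split; apply: mem_nth; rewrite p7.
    have [r' rr' [con_r r'id]] := to_v _ (realizes_swapped p_uniq p7 ecore rw).
    exists r'.
      apply: agree_outside_trans rr'.
      by apply: agree_outside_tperm; rewrite inE.
    split=> //; apply: connect_trans con_r; apply/connect1/FS_swap.
      exact: Xp.
    rewrite /Y /graph_compl (inj_eq perm_inj) nth_uniq ?p7 // e12 /=.
    apply: contra efoe; rewrite !rw // !nth_mkseq // /exchange !eqxx.
    rewrite [e.2 == e.1]eq_sym (negPf e12) foe_sym.
    by apply: tad_foe; apply: v7.
  rewrite inE => /eqP->; split=> [l l7|r rid]; first by rewrite nth_iota.
  by exists r.
have normalize r : agree_outside [set x in p] s r ->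
  exists2 r', agree_outside [set x in p] r r' & connect (FS X Y) r r' /\
    realizes x0 p q r' (iota 0 7).
  move=> sr; pose w := map (index^~ q) (map r p).
  have [|_ to_id] := normalizable_explored w.
    apply: (allP (all_explored k7)); rewrite mem_permutations.
    have -> : iota 0 7 = map (index^~ q) q.
      apply: (@eq_from_nth _ 0); rewrite ?size_map ?size_iota ?q7 // => i i7.
      by rewrite nth_iota // (nth_map x0) ?q7 // index_uniq ?q7.
    by apply: perm_map; rewrite perm_sym q_perm.
  apply: to_id => l l7.
  rewrite /w (nth_map x0) ?size_map ?p7 // (nth_map x0) ?p7 // nth_index //.
  by rewrite (perm_mem (q_perm r sr)) map_f // mem_nth // p7.
have [s' ss' [con_s s'id]] := normalize s (fun _ _ => erefl).
have [t' tt' [con_t t'id]] := normalize t st.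
have s't' : s' = t'.
  apply/permP=> x; have [xp|xp] := boolP (x \in p).
    by rewrite -(nth_index x0 xp) s'id ?t'id // -p7 index_mem.
  by rewrite -ss' ?inE // st ?inE // tt' ?inE.
apply: connect_trans con_s _; rewrite s't'.
by rewrite (sym_connect_sym (FS_sym Xsym Ysym)).
Qed.

(** * Connected graphs containing the core *)

Lemma FS_tadpole_connected (n c : nat) (X : rel 'I_n) (x0 : 'I_n)
    (p : seq 'I_n) :
    symmetric X -> graph_connected X -> uniq p -> size p = 7 ->
    (forall e, e \in core_edges -> X (nth x0 p e.1) (nth x0 p e.2)) ->
  graph_connected (FS X (graph_compl (@tadpole n c))).
Proof.
move=> Xsym Xcon p_uniq p7 Xp.
have p_card : #|[set x in p]| = 7 by rewrite cardsE (card_uniqP p_uniq).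
apply: rearrangeable_setT (rearrangeable_core _ Xsym p_uniq p7 Xp) => //.
- exact/graph_compl_sym/tadpole_sym.
- by rewrite p_card.
by move=> x y xy Yxy; rewrite p_card card_tadpole_blocked.
Qed.

Definition leg_vertex (lambda : seq nat) (i j : nat) (ilt : i < size lambda)
    (jlt : j < nth 0 lambda i) : spider_vertex lambda :=
  Some (Tagged (fun i : 'I_(size lambda) => 'I_(nth 0 lambda i))
          (Ordinal jlt : 'I_(nth 0 lambda (Ordinal ilt)))).

Lemma spider_connected (lambda : seq nat) : graph_connected (@spider lambda).
Proof.
suff toC v : connect (@spider lambda) None v.
  move=> u v; apply: connect_trans (toC v).
  by rewrite (sym_connect_sym (@spider_sym lambda)).
case: v => [[i [j jlt]]|]; last exact: connect0.
elim: j jlt => [|j IHj] jlt; first by apply/connect1.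
apply: connect_trans (IHj (ltnW jlt)) (connect1 _).
by rewrite /spider /= !eqxx.
Qed.

Lemma graph_iso_connected (T1 T2 : finType) (e1 : rel T1) (e2 : rel T2) :
  graph_iso e1 e2 -> graph_connected e2 -> graph_connected e1.
Proof.
case=> f [g fK gK] fe con x y; rewrite -(fK x) -(fK y).
have /connectP[pth] := con (f x) (f y).
elim: pth (f x) => [|v pth IHp] u /= => [_ ->|/andP[uv /IHp{}IHp] /IHp].
  exact: connect0.
by apply/connect_trans/connect1; rewrite fe !gK.
Qed.

Theorem theorem3p1 (a b n : nat) (hab : b <= a) (hb : 2 <= b)
    (hn : n = a + b + 3) (X : rel 'I_n)
    (hX : graph_iso X (@spider [:: a; b; 1; 1]))
    (c : nat) (hc3 : 3 <= c) (hcn : c <= n) :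
  graph_connected (FS X (graph_compl (@tadpole n c))).
Proof.
pose lam := [:: a; b; 1; 1].
have Xcon := graph_iso_connected hX (@spider_connected lam).
case: hX => f [g fK gK] fX.
have Xsym : symmetric X by move=> x y; rewrite !fX spider_sym.
have ha : 2 <= a := leq_trans hb hab.
pose leg i j ilt jlt := @leg_vertex lam i j ilt jlt.
pose core : seq (spider_vertex lam) :=
  [:: leg 0 1 isT ha; leg 0 0 isT (ltnW ha); None; leg 1 0 isT (ltnW hb);
      leg 1 1 isT hb; leg 2 0 isT isT; leg 3 0 isT isT].
apply: (@FS_tadpole_connected n c X (g None) (map g core)) => //.
  rewrite (map_inj_uniq (can_inj gK)).
  (* Comparing legs and depths as numbers lets uniqueness compute, whereas
     equality in the dependent vertex type is stuck on the variables a and b. *)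
  pose label (v : spider_vertex lam) : option (nat * nat) :=
    if v is Some q then Some (tag q : nat, tagged q : nat) else None.
  exact: (@map_uniq _ _ label).
by apply/allP; rewrite /= !fX !gK.
Qed.
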